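(* Assume there exists $k\ge0$ such that \[ |\mathrm{Im}\,\langle Dz,z\rangle_{H_{-1/2}\times H_{1/2}}|\le k\,\mathrm{Re}\,\langle Dz,z\rangle_{H_{-1/2}\times H_{1/2}},\qquad z\in H_{1/2}. \] If $\delta>0$, then \[ \sigma(\mathcal A)\subset\overline{W(\mathcal A)}\subset\Big\{\lambda\in\mathbb C\ \Big|\ -\gamma\le\mathrm{Re}\,\lambda\le0,\ |\mathrm{Im}\,\lambda|\le k|\mathrm{Re}\,\lambda|+2\sqrt{\tfrac1\delta|\mathrm{Re}\,\lambda|}\,\Big\}. \]
   Context: $H$ is a (complex) Hilbert space with inner product $\langle\cdot,\cdot\rangle$ and norm $\|\cdot\|$. $A_0:\mathcal D(A_0)\subset H\to H$ is a self-adjoint, uniformly positive linear operator with $0\in\rho(A_0)$. $H_{1/2}:=\mathcal D(A_0^{1/2})$ with norm $\|z\|_{H_{1/2}}=\|A_0^{1/2}z\|$ and inner product $\langle x,y\rangle_{H_{1/2}}=\langle A_0^{1/2}x,A_0^{1/2}y\rangle$; $H_{-1/2}$ is the dual of $H_{1/2}$ with respect to the pivot space $H$, i.e. the completion of $H$ with respect to $\|A_0^{-1/2}z\|$; $\langle\cdot,\cdot\rangle_{H_{-1/2}\times H_{1/2}}$ is the duality pairing, with $\langle z',z\rangle_{H_{-1/2}\times H_{1/2}}=\langle z',z\rangle$ for $z'\in H$, $z\in H_{1/2}$. $H_1:=\mathcal D(A_0)$. $A_0$ extends to a bounded operator $H_{1/2}\to H_{-1/2}$, again denoted $A_0$. $D:H_{1/2}\to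 H_{-1/2}$ is a bounded linear operator such that $\mathrm{Re}\,\langle Dz,z\rangle_{H_{-1/2}\times H_{1/2}}\ge 0$ for all $z\in H_{1/2}$, and $D$ maps $H_1$ into $H$. The operator $\mathcal A$ in $H_{1/2}\times H$ is $\mathcal A=\begin{bmatrix}0&I\\-A_0&-D\end{bmatrix}$ with $\mathcal D(\mathcal A)=\{(z,w)^\top\in H_{1/2}\times H_{1/2}\mid A_0z+Dw\in H\}$. Its numerical range is $W(\mathcal A)=\{\langle\mathcal Ax,x\rangle_{H_{1/2}\times H}\mid x\in\mathcal D(\mathcal A),\ \|x\|=1\}$. Constants: $\gamma=\sup_{z\in H_{1/2}\setminus\{0\}}\frac{\mathrm{Re}\,\langle Dz,z\rangle_{H_{-1/2}\times H_{1/2}}}{\|z\|^2}\in[0,\infty]$ and $\delta=\inf_{z\in H_{1/2}\setminus\{0\}}\frac{\mathrm{Re}\,\langle Dz,z\rangle_{H_{-1/2}\times H_{1/2}}}{\|z\|_{H_{1/2}}^2}$. If $\gamma=\infty$, the condition $-\gamma\le\mathrm{Re}\,\lambda$ is void. *)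

(* Defs.v *)
From HB Require Import structures.
From mathcomp Require Import all_boot all_order all_algebra sesquilinear.
From mathcomp Require Import all_classical all_reals all_analysis.
From mathcomp Require Import complex.

Set Implicit Arguments.
Unset Strict Implicit.
Unset Printing Implicit Defensive.

Import Order.TTheory GRing.Theory Num.Theory numFieldNormedType.Exports.
Local Open Scope classical_set_scope.
Local Open Scope ring_scope.
Local Open Scope complex_scope.

Section CauchySchwarz.
Variables (C : numClosedFieldType) (U : lmodType C).
Variable f : {dot U for @Num.conj C}.

Lemma dot_CauchySchwarz u v : `|f u v| <= sqrtC (f u u) * sqrtC (f v v).
Proof.
rewrite -(@ler_pXn2r _ 2) ?nnegrE ?mulr_ge0 ?sqrt_dnorm_ge0 //.
rewrite exprMn !sqrtCK.
have [->|v0] := eqVneq v 0; first by rewrite (linear0r f u) (linear0r f 0) normr0 expr0n mulr0.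
have fv : 0 < f v v by rewrite dnorm_gt0.
pose a := f u v / f v v; have := dnorm_ge0 f (u - a *: v).
have ou : f (u - a *: v) v = 0.
  by rewrite linearBl linearZl_LR /= /a divfK ?subrr// gt_eqF.
rewrite linearBr linearZr_LR /= ou mulr0 subr0 linearBl linearZl_LR /=.
rewrite subr_ge0 /a mulrAC ler_pdivrMr //.
by rewrite [f v u]hermC expr0 mul1r normCK.
Qed.

Lemma dot_triangle u v :
  sqrtC (f (u + v) (u + v)) <= sqrtC (f u u) + sqrtC (f v v).
Proof.
rewrite -(@ler_pXn2r _ 2) ?nnegrE ?addr_ge0 ?sqrt_dnorm_ge0 //.
rewrite sqrrD !sqrtCK dnormD addrAC lerD2r lerD2l.
apply: (@le_trans _ _ (`|f u v| *+ 2)); last by rewrite lerMn2r dot_CauchySchwarz.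
have re : f u v + (f u v)^*%R \is Num.real.
  by rewrite CrealE rmorphD /= conjCK addrC.
rewrite (le_trans (real_ler_norm re)) // (le_trans (ler_normD _ _)) //.
by rewrite norm_conjC mulr2n.
Qed.

Lemma dot_normZ a u : sqrtC (f (a *: u) (a *: u)) = `|a| * sqrtC (f u u).
Proof.
by rewrite dnormZ sqrtCM ?nnegrE ?exprn_ge0 ?dnorm_ge0 // sqrCK.
Qed.

Lemma dot_norm_eq0 u : sqrtC (f u u) = 0 -> u = 0.
Proof. by move/eqP; rewrite sqrt_dnorm_eq0 => /eqP. Qed.

End CauchySchwarz.

(* Inner products are linear in the first and antilinear in the second
   argument. *)
HB.mixin Record NormedModule_isPreHilbert (R : realType) V
    & NormedModule R[i] V := {
  inner : {dot V for @Num.conj R[i]} ;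
  innerE : forall x : V, inner x x = `|x| ^+ 2
}.

#[short(type="preHilbertType")]
HB.structure Definition PreHilbert (R : realType) :=
  {V of NormedModule R[i] V & NormedModule_isPreHilbert R V}.

#[short(type="hilbertType")]
HB.structure Definition Hilbert (R : realType) :=
  {V of PreHilbert R V & Complete V}.

Lemma inner_CauchySchwarz (R : realType) (V : preHilbertType R) (x y : V) :
  `|inner x y| <= `|x| * `|y|.
Proof.
have := dot_CauchySchwarz (@inner R V) x y.
by rewrite !innerE !sqrCK.
Qed.

(* The library norm of a complex normed space takes its values in [R[i]]. *)
Definition rnorm (R : realType) (V : normedModType R[i]) (x : V) : R :=
  complex.Re `|x|.

Lemma rnormE (R : realType) (V : normedModType R[i]) (x : V) :
  (rnorm x)%:C = `|x|.
Proof. by rewrite RRe_real // normr_real. Qed.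

(* The Hilbert-space direct sum; the library norm on [V * W] is the maximum
   norm, hence the alias. *)
Definition hsum (V W : Type) : Type := (V * W)%type.

Section HilbertSum.
Variables (R : realType) (V W : preHilbertType R).

HB.instance Definition _ := GRing.Lmodule.copy (hsum V W) (V * W)%type.

Definition hsum_inner (x y : hsum V W) : R[i] :=
  inner x.1 y.1 + inner x.2 y.2.

Fact hsum_inner_bilinear :
  bilinear_for *%R (@Num.conj R[i] \; *%R) hsum_inner.
Proof.
split=> [y a x x'|x a y y'] /=; rewrite /hsum_inner /=.
  by rewrite !linearPl /= mulrDr addrACA.
by rewrite !linearPr /= mulrDr addrACA.
Qed.

HB.instance Definition _ :=
  bilinear_isBilinear.Build R[i] (hsum V W) (hsum V W) R[i] _ _
    hsum_inner hsum_inner_bilinear.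

Fact hsum_inner_hermitian x y :
  hsum_inner x y = (-1) ^+ false * Num.conj (hsum_inner y x).
Proof.
rewrite expr0 mul1r /hsum_inner rmorphD /=.
by congr (_ + _); rewrite hermC expr0 mul1r.
Qed.

HB.instance Definition _ :=
  isHermitianSesquilinear.Build R[i] (hsum V W) false (@Num.conj R[i])
    hsum_inner hsum_inner_hermitian.

Fact hsum_inner_gt0 (x : hsum V W) : x != 0 -> 0 < hsum_inner x x.
Proof.
case: x => x y; rewrite /hsum_inner /= => xy0.
rewrite lt_def addr_ge0 ?dnorm_ge0 // andbT.
rewrite paddr_eq0 ?dnorm_ge0 // !dnorm_eq0.
by apply: contraNN xy0 => /andP[/eqP -> /eqP ->].
Qed.

HB.instance Definition _ :=
  isDotProduct.Build R[i] (hsum V W) hsum_inner hsum_inner_gt0.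

HB.instance Definition _ := Lmodule_isNormed.Build R[i] (hsum V W)
  (dot_triangle hsum_inner) (dot_normZ hsum_inner)
  (@dot_norm_eq0 _ _ hsum_inner).

Fact hsum_innerE (x : hsum V W) : hsum_inner x x = `|x| ^+ 2.
Proof. by rewrite [`|x|]/(sqrtC _) sqrtCK. Qed.

HB.instance Definition _ := NormedModule_isPreHilbert.Build R (hsum V W) hsum_innerE.

End HilbertSum.

(* Only the values of [op_fun] on [dom] are meaningful. *)
Record operator (K : pzRingType) (V W : lmodType K) := Operator {
  dom : set V ;
  op_fun :> V -> W ;
  dom0 : dom 0 ;
  dom_linear : forall (a : K) x y, dom x -> dom y -> dom (a *: x + y) ;
  op_linear : forall (a : K) x y, dom x -> dom y ->
    op_fun (a *: x + y) = a *: op_fun x + op_fun y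
}.

Section Operators.
Variables (R : realType).

Definition resolvent_set (V : normedModType R[i]) (T : operator V V) :
    set R[i] :=
  [set l | set_bij (dom T) setT (fun x => T x - l *: x) /\
    exists M : R, forall x, dom T x -> rnorm x <= M * rnorm (T x - l *: x)].

Definition spectrum (V : normedModType R[i]) (T : operator V V) : set R[i] :=
  ~` resolvent_set T.

Definition numerical_range (V : preHilbertType R) (T : operator V V) :
    set R[i] :=
  [set inner (T x) x | x in dom T `&` [set x | `|x| = 1]].

Definition bounded_op (V W : normedModType R[i]) (T : V -> W) : Prop :=
  exists M : R, forall x, rnorm (T x) <= M * rnorm x.

Definition self_adjoint (V : preHilbertType R) (T : operator V V) : Prop :=
  dense (dom T) /\
  forall y z, (dom T y /\ T y = z) <->
    (forall x, dom T x -> inner (T x) y = inner x z).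

(* On [R[i]], [0 <= a] means that [a] is real and nonnegative. *)
Definition nonnegative (V : preHilbertType R) (T : operator V V) : Prop :=
  forall x, dom T x -> 0 <= inner (T x) x.

Definition uniformly_positive (V : preHilbertType R) (T : operator V V) :
    Prop :=
  exists2 c : R, 0 < c &
    forall x, dom T x -> c%:C * `|x| ^+ 2 <= inner (T x) x.

End Operators.

Record posop (R : realType) (H : hilbertType R) := Posop {
  posop_op :> operator H H ;
  posop_sa : self_adjoint posop_op ;
  posop_up : uniformly_positive posop_op ;
  posop_res0 : resolvent_set posop_op 0
}.

(* The square root [A ^ (1/2)], pinned down by its defining property: it is the
   unique nonnegative self-adjoint operator whose square is [A]. *)
Record sqrtop (R : realType) (H : hilbertType R) (A : posop H) := Sqrtop {
  sqrt_op :> operator H H ;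
  sqrt_sa : self_adjoint sqrt_op ;
  sqrt_ge0 : nonnegative sqrt_op ;
  sqrt_dom : [set x | dom sqrt_op x /\ dom sqrt_op (sqrt_op x)] = dom A ;
  sqrt_sqr : forall x, dom A x -> sqrt_op (sqrt_op x) = A x
}.

Section Bounds.
Variables (R : realType) (H : hilbertType R) (A : posop H) (S : sqrtop A).

Lemma sqrt_sym x y : dom S x -> dom S y -> inner (S x) y = inner x (S y).
Proof. by move=> Sx Sy; apply: ((sqrt_sa S).2 y (S y)).1. Qed.

Lemma posop_surj z : exists2 u, dom A u & A u = z.
Proof.
have [[_ _ /(_ z Logic.I)[u Au <-]] _] := posop_res0 A.
by exists u => //; rewrite scale0r subr0.
Qed.

Lemma sqrt_surj z : exists u, [/\ dom S u, dom S (S u) & S (S u) = z].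
Proof.
have [u Au <-] := posop_surj z.
have : [set x | dom S x /\ dom S (S x)] u by rewrite sqrt_dom.
by case=> Su SSu; exists u; split=> //; exact: sqrt_sqr.
Qed.

Lemma sqrt_ker z : dom S z -> S z = 0 -> z = 0.
Proof.
move=> Sz Sz0; have [u [Su SSu uz]] := sqrt_surj z.
apply/eqP; rewrite -(dnorm_eq0 (@inner R H)) -{1}uz sqrt_sym //.
by rewrite Sz0 linear0r.
Qed.

Lemma sqrt_bounded_below :
  exists M : R, forall z, dom S z -> rnorm z <= M * rnorm (S z).
Proof.
have [_ [M0 hM0]] := posop_res0 A.
have CS (x y : H) : complex.Re `|inner x y| <= rnorm x * rnorm y.
  by rewrite -lecR rmorphM /= !rnormE inner_CauchySchwarz.
have sq (x : H) : rnorm x ^+ 2 = complex.Re `|inner x x|.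
  apply: complexI; rewrite [RHS]RRe_real ?normr_real // innerE.
  by rewrite ger0_norm ?exprn_ge0 // [LHS]rmorphXn; congr (_ ^+ 2); exact: rnormE.
have rn (x : H) : 0 <= rnorm x by rewrite -ler0c rnormE.
exists (Num.max M0 1) => z Sz; have [u [Su SSu uz]] := sqrt_surj z.
have Au : dom A u by rewrite -(sqrt_dom S).
have := hM0 u Au; rewrite scale0r subr0 -(sqrt_sqr S Au) uz => uM.
have h1 : rnorm z ^+ 2 <= rnorm (S u) * rnorm (S z).
  by rewrite sq -[X in inner X _]uz sqrt_sym.
have h2 : rnorm (S u) ^+ 2 <= rnorm z * rnorm u.
  by rewrite sq -sqrt_sym ?uz.
have [z0|z0] := eqVneq (rnorm z) 0.
  by rewrite z0 mulr_ge0 // le_max ler01 orbT.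
have zp : 0 < rnorm z by rewrite lt_def z0 rn.
set M := Num.max M0 1.
have M1 : 1 <= M by rewrite le_max lexx orbT.
have h3 : rnorm (S u) ^+ 2 <= M * rnorm z ^+ 2.
  rewrite (le_trans h2) // expr2 mulrCA ler_wpM2l // (le_trans uM) //.
  by rewrite ler_wpM2r // le_max lexx.
have h4 : rnorm z ^+ 2 <= M * rnorm (S z) ^+ 2.
  rewrite -(@ler_pM2r _ (rnorm z ^+ 2)) ?exprn_gt0 // -expr2.
  rewrite (@le_trans _ _ ((rnorm (S u) * rnorm (S z)) ^+ 2)) //.
    by rewrite ler_pXn2r ?nnegrE ?mulr_ge0 ?exprn_ge0.
  by rewrite exprMn [leRHS]mulrAC ler_wpM2r ?exprn_ge0.
rewrite -(@ler_pXn2r _ 2) ?nnegrE ?mulr_ge0 ?(le_trans ler01 M1) //.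
rewrite (le_trans h4) // exprMn ler_wpM2r ?exprn_ge0 //.
by rewrite expr2 ler_peMl // (le_trans ler01).
Qed.

End Bounds.

(* The antidual: bounded antilinear functionals, with the operator norm.  It is
   antilinear functionals that make the pairing [f x] linear in [f] and
   antilinear in [x], like an inner product. *)
Section Antidual.
Variables (R : realType) (V : normedModType R[i]).

Definition antidual_pred : {pred V -> R[i]^o} := fun f => `[<
  (forall a x y, f (a *: x + y) = Num.conj a * f x + f y) /\
  exists M : R, forall x, `|f x| <= M%:C * `|x| >].

Fact antidual_submod : submod_closed antidual_pred.
Proof.
split=> [|l f g /asboolP[fl [M hM]] /asboolP[gl [N hN]]]; apply/asboolP.
  split=> [a x y|]; first by rewrite mulr0 addr0.
  by exists 0 => x; rewrite normr0 mul0r.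
split=> [a x y|].
  rewrite /= !fctE /= fl gl /GRing.scale /= !mulrDr addrACA.
  by congr (_ + _ + _); rewrite mulrCA.
have [n nE] : exists n : R, n%:C = `|l|.
  by exists (complex.Re `|l|); rewrite RRe_real ?normr_real.
exists (n * M + N) => x.
have -> : (n * M + N)%:C = `|l| * M%:C + N%:C by rewrite -nE -rmorphM -rmorphD.
rewrite (le_trans (ler_normD _ _)) //.
by rewrite mulrDl lerD // normrM -mulrA ler_wpM2l.
Qed.

HB.instance Definition _ :=
  GRing.isSubmodClosed.Build R[i] (V -> R[i]^o) antidual_pred antidual_submod.

Record antidual := Antidual {
  antidual_fun :> V -> R[i]^o ;
  antidual_funP : antidual_fun \in antidual_pred
}.

HB.instance Definition _ := [isSub for antidual_fun].
HB.instance Definition _ := [Choice of antidual by <:].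
HB.instance Definition _ := [SubChoice_isSubLmodule of antidual by <:].

Implicit Types f g : antidual.

Lemma antidual_linear f a x y : f (a *: x + y) = Num.conj a * f x + f y.
Proof. by have /asboolP[] := antidual_funP f. Qed.

Lemma antidual_bounded f : exists M : R, forall x, `|f x| <= M%:C * `|x|.
Proof. by have /asboolP[] := antidual_funP f. Qed.

Lemma antidual_ext f g : f =1 g -> f = g.
Proof. by move=> fg; apply: val_inj; apply/funext. Qed.

Lemma antidualZ f a x : f (a *: x) = Num.conj a * f x.
Proof.
have f0 : f 0 = 0.
  have := antidual_linear f 1 0 0; rewrite scale1r addr0 conjC1 mul1r.
  by rewrite -{1}[f 0]addr0 => /addrI.
by rewrite -{1}[a *: x]addr0 antidual_linear f0 addr0.
Qed.

Definition antidual_norm f : R :=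
  sup [set complex.Re `|f x| | x in [set x | `|x| <= 1]].

Let ball_im f := [set complex.Re `|f x| | x in [set x : V | `|x| <= 1]].

Let ball_im_sup f : has_sup (ball_im f).
Proof.
split; first by exists (complex.Re `|f 0|), 0; rewrite //= normr0 ler01.
have [M hM] := antidual_bounded f.
exists `|M| => _ [x x1 <-].
rewrite -lecR [leLHS]RRe_real ?normr_real // (le_trans (hM x)) //.
rewrite (@le_trans _ _ (`|M|%:C * `|x|)) ?ler_wpM2r ?lecR ?ler_norm //.
by rewrite ler_piMr // ler0c.
Qed.

Let antidual_norm_ge f x : `|x| <= 1 -> complex.Re `|f x| <= antidual_norm f.
Proof. by move=> x1; apply: ub_le_sup; [exact: (ball_im_sup f).2|exists x]. Qed.

Lemma antidual_norm_bound f x : `|f x| <= (antidual_norm f)%:C * `|x|.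
Proof.
have [->|x0] := eqVneq x 0.
  by rewrite -[0](scale0r 0) antidualZ conjC0 mul0r !normr0 scale0r normr0 mulr0.
have xp : 0 < `|x| by rewrite normr_gt0.
have := @antidual_norm_ge f (`|x|^-1 *: x).
rewrite normrZ normfV normr_id mulVf ?gt_eqF // => /(_ (lexx _)).
rewrite antidualZ -lecR [leLHS]RRe_real ?normr_real //.
by rewrite normrM norm_conjC normfV normr_id ler_pdivrMl // mulrC.
Qed.

Lemma antidual_norm_le f (M : R) :
  (forall x, `|x| <= 1 -> `|f x| <= M%:C) -> antidual_norm f <= M.
Proof.
move=> hM; apply: ge_sup; first exact: (ball_im_sup f).1.
by move=> _ [x x1 <-]; rewrite -lecR RRe_real ?normr_real ?hM.
Qed.

Let antidual_normD f g :
  (antidual_norm (f + g))%:C <= (antidual_norm f)%:C + (antidual_norm g)%:C.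
Proof.
rewrite -rmorphD lecR; apply: antidual_norm_le => x x1.
rewrite (le_trans (ler_normD _ _)) // rmorphD lerD //=;
  rewrite -[leLHS](@RRe_real R) ?normr_real // lecR; exact: antidual_norm_ge.
Qed.

Let antidual_normZ_le (l : R[i]) f :
  (antidual_norm (l *: f))%:C <= `|l| * (antidual_norm f)%:C.
Proof.
have [n nE] : exists n : R, n%:C = `|l|.
  by exists (complex.Re `|l|); rewrite RRe_real ?normr_real.
rewrite -nE -rmorphM lecR; apply: antidual_norm_le => x x1.
have -> : (n * antidual_norm f)%:C = `|l| * (antidual_norm f)%:C.
  by rewrite -nE -rmorphM.
rewrite normrM ler_wpM2l // (le_trans (antidual_norm_bound f x)) //.
rewrite ler_piMr // ler0c.
apply: le_trans (@antidual_norm_ge f 0 _); last by rewrite normr0 ler01.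
by rewrite -ler0c RRe_real ?normr_real.
Qed.

Let antidual_normZ (l : R[i]) f :
  (antidual_norm (l *: f))%:C = `|l| * (antidual_norm f)%:C.
Proof.
apply/le_anti; rewrite antidual_normZ_le /=.
have [->|l0] := eqVneq l 0.
  rewrite normr0 mul0r lecR.
  apply: le_trans (@antidual_norm_ge _ 0 _); last by rewrite normr0 ler01.
  by rewrite -ler0c RRe_real ?normr_real.
rewrite -ler_pdivlMl ?normr_gt0 // -normfV.
by apply: le_trans (antidual_normZ_le _ _); rewrite scalerA mulVf // scale1r.
Qed.

Let antidual_norm_eq0 f : (antidual_norm f)%:C = 0 -> f = 0.
Proof.
move=> f0; apply: antidual_ext => x; apply/eqP.
by rewrite -normr_le0 (le_trans (antidual_norm_bound _ _)) // f0 mul0r.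
Qed.

HB.instance Definition _ := Lmodule_isNormed.Build R[i] antidual
  antidual_normD antidual_normZ antidual_norm_eq0.

End Antidual.

Section FormDomain.
Variables (R : realType) (H : hilbertType R) (A : posop H) (S : sqrtop A).

Definition half_pred : {pred H} := fun x => `[< dom S x >].

Fact half_submod : submod_closed half_pred.
Proof.
split=> [|a x y /asboolP Sx /asboolP Sy]; apply/asboolP; first exact: dom0.
exact: dom_linear.
Qed.

HB.instance Definition _ :=
  GRing.isSubmodClosed.Build R[i] H half_pred half_submod.

(* [H_(1/2)], the domain of [A ^ (1/2)]. *)
Record Hhalf := Half { half_val : H ; half_valP : half_val \in half_pred }.

HB.instance Definition _ := [isSub for half_val].
HB.instance Definition _ := [Choice of Hhalf by <:].
HB.instance Definition _ := [SubChoice_isSubLmodule of Hhalf by <:].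

Lemma half_dom (z : Hhalf) : dom S (val z).
Proof. exact/asboolP/half_valP. Qed.

Definition half_inner (x y : Hhalf) : R[i] := inner (S (val x)) (S (val y)).

Fact half_inner_bilinear :
  bilinear_for *%R (@Num.conj R[i] \; *%R) half_inner.
Proof.
split=> [y a x x'|x a y y'] /=; rewrite /half_inner linearP op_linear /=;
  by [exact: linearPl|exact: linearPr|exact: half_dom].
Qed.

HB.instance Definition _ :=
  bilinear_isBilinear.Build R[i] Hhalf Hhalf R[i] _ _
    half_inner half_inner_bilinear.

Fact half_inner_hermitian x y :
  half_inner x y = (-1) ^+ false * Num.conj (half_inner y x).
Proof. exact: hermC. Qed.

HB.instance Definition _ :=
  isHermitianSesquilinear.Build R[i] Hhalf false (@Num.conj R[i])
    half_inner half_inner_hermitian.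

Fact half_inner_gt0 (x : Hhalf) : x != 0 -> 0 < half_inner x x.
Proof.
move=> x0; rewrite dnorm_gt0; apply: contra_neq x0 => /(sqrt_ker (half_dom x)).
by move=> x0; apply: val_inj.
Qed.

HB.instance Definition _ :=
  isDotProduct.Build R[i] Hhalf half_inner half_inner_gt0.

HB.instance Definition _ := Lmodule_isNormed.Build R[i] Hhalf
  (dot_triangle half_inner) (dot_normZ half_inner)
  (@dot_norm_eq0 _ _ half_inner).

Fact half_innerE (x : Hhalf) : half_inner x x = `|x| ^+ 2.
Proof. by rewrite [`|x|]/(sqrtC _) sqrtCK. Qed.

HB.instance Definition _ := NormedModule_isPreHilbert.Build R Hhalf half_innerE.

Lemma half_norm (z : Hhalf) : `|z| = `|S (val z)|.
Proof.
apply/eqP; rewrite -(@eqrXn2 _ 2) //.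
by rewrite -(innerE z) -(innerE (S (val z))).
Qed.

Fact pivot_subproof (v : H) :
  (fun z : Hhalf => inner v (val z)) \in @antidual_pred R Hhalf.
Proof.
apply/asboolP; split=> [a x y|].
  have -> : val (a *: x + y) = a *: val x + val y by rewrite linearP.
  exact: linearPr.
have [M hM] := sqrt_bounded_below S.
exists (rnorm v * M) => z; rewrite (le_trans (inner_CauchySchwarz _ _)) //.
have -> : (rnorm v * M)%:C = `|v| * M%:C by rewrite -rnormE -rmorphM.
rewrite -mulrA ler_wpM2l // half_norm -!rnormE -rmorphM lecR.
by apply: hM; exact: half_dom.
Qed.

(* The embedding of the pivot space [H] into [H_(-1/2)]. *)
Definition pivot (v : H) : antidual Hhalf := Antidual (pivot_subproof v).

Lemma pivotE v z : pivot v z = inner v (val z).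
Proof. by []. Qed.

Lemma pivot_linear a v w : pivot (a *: v + w) = a *: pivot v + pivot w.
Proof. by apply: antidual_ext => z; rewrite pivotE linearPl. Qed.

Lemma pivot_inj : injective pivot.
Proof.
move=> v w vw; apply/eqP; rewrite -subr_eq0 -normr_eq0; apply: contraT => n0.
have {}n0 : 0 < `|v - w| by rewrite lt_def n0 normr_ge0.
have [|x [xB Sx]] := (sqrt_sa S).1 (ball (v - w) `|v - w|) _
  (ball_open _ _).
  by exists (v - w); exact: ballxx.
have xE : inner (v - w) x = 0.
  rewrite linearBl /=.
  have -> : x = val (Half (introT (asboolP _) Sx)) by [].
  by rewrite -!pivotE vw subrr.
have : `|v - w| ^+ 2 <= `|v - w| * `|v - w - x|.
  rewrite -innerE -[X in X <= _]ger0_norm ?dnorm_ge0 //.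
  by rewrite -[inner _ _]subr0 -xE -linearBr inner_CauchySchwarz.
rewrite expr2 ler_pM2l // => /le_lt_trans; move: xB.
rewrite -ball_normE /= => xB /(_ _ xB); by rewrite ltxx.
Qed.

Fact posop_ext_subproof (z : Hhalf) :
  (fun x : Hhalf => inner z x) \in @antidual_pred R Hhalf.
Proof.
apply/asboolP; split=> [a x y|]; first exact: linearPr.
by exists (rnorm z) => x; rewrite rnormE inner_CauchySchwarz.
Qed.

(* The bounded extension of [A] to an operator from [H_(1/2)] to [H_(-1/2)],
   given by the form [<A^(1/2) z, A^(1/2) x>]; see [posop_extE] and
   [posop_ext_norm]. *)
Definition posop_ext (z : Hhalf) : antidual Hhalf := Antidual (posop_ext_subproof z).

Lemma posop_extE (z : Hhalf) : dom A (val z) -> posop_ext z = pivot (A (val z)).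
Proof.
move=> Az; apply: antidual_ext => x; rewrite pivotE -(sqrt_sqr S Az).
have [] : [set x | dom S x /\ dom S (S x)] (val z) by rewrite sqrt_dom.
by move=> _ SSz; rewrite sqrt_sym //; exact: half_dom.
Qed.

Lemma posop_ext_linear a x y :
  posop_ext (a *: x + y) = a *: posop_ext x + posop_ext y.
Proof. by apply: antidual_ext => z; exact: linearPl. Qed.

Lemma posop_ext_norm z : `|posop_ext z| <= `|z|.
Proof.
rewrite -[leRHS]rnormE lecR; apply: antidual_norm_le => x x1.
rewrite rnormE (le_trans (inner_CauchySchwarz _ _)) //.
by rewrite ler_piMr.
Qed.

End FormDomain.

(* [H_(-1/2)]; the pairing of [f] and [z] is [f z]. *)
Notation Hmhalf S := (antidual (Hhalf S)).

Section BlockOperator.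
Variables (R : realType) (H : hilbertType R) (A : posop H) (S : sqrtop A).
Variable D : {linear Hhalf S -> Hmhalf S}.

(* [x.2] seen as an element of [Hhalf S]; this is meaningful when [x.2] is in
   the domain of [S]. *)
Let snd_half (x : hsum (Hhalf S) H) : Hhalf S := insubd 0 x.2.

Let lower_row (x : hsum (Hhalf S) H) : Hmhalf S :=
  posop_ext x.1 + D (snd_half x).

Definition block_dom : set (hsum (Hhalf S) H) :=
  [set x | dom S x.2 /\ range (@pivot R H A S) (lower_row x)].

Definition block_fun (x : hsum (Hhalf S) H) : hsum (Hhalf S) H :=
  (snd_half x, - xget 0 [set v | pivot S v = lower_row x]).

Let snd_half_val x : dom S x.2 -> val (snd_half x) = x.2.
Proof. by move=> Sx; rewrite insubdK //; apply/asboolP. Qed.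

Let snd_half_linear a x y : dom S x.2 -> dom S y.2 ->
  snd_half (a *: x + y) = a *: snd_half x + snd_half y.
Proof.
move=> Sx Sy; apply: val_inj; rewrite linearP /=.
by rewrite !snd_half_val //; exact: dom_linear.
Qed.

Let lower_row_linear a x y : dom S x.2 -> dom S y.2 ->
  lower_row (a *: x + y) = a *: lower_row x + lower_row y.
Proof.
move=> Sx Sy; rewrite /lower_row snd_half_linear // (linearP D).
by rewrite /= posop_ext_linear scalerDr addrACA.
Qed.

Let lower_rowE x v : pivot S v = lower_row x ->
  block_fun x = (snd_half x, - v).
Proof.
move=> vx; congr (_, - _); apply: (@pivot_inj R H A S); rewrite vx.
by apply: (@xgetPex _ 0 [set w | pivot S w = lower_row x]); exists v.
Qed.

Fact block_dom0 : block_dom 0.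
Proof.
split; first exact: dom0.
exists 0 => //; apply: antidual_ext => z; rewrite pivotE linear0l.
have s0 : snd_half 0 = 0.
  by apply: val_inj; rewrite snd_half_val ?linear0 //; exact: dom0.
rewrite /lower_row s0 (linear0 D) addr0; apply/esym.
by apply: (linear0l (@inner R (Hhalf S))).
Qed.

Fact block_dom_linear (a : R[i]) x y :
  block_dom x -> block_dom y -> block_dom (a *: x + y).
Proof.
move=> [Sx [v _ vx]] [Sy [w _ wy]]; split; first exact: dom_linear.
by exists (a *: v + w) => //; rewrite pivot_linear vx wy lower_row_linear.
Qed.

Fact block_linear (a : R[i]) x y : block_dom x -> block_dom y ->
  block_fun (a *: x + y) = a *: block_fun x + block_fun y.
Proof.
move=> [Sx [v _ vx]] [Sy [w _ wy]].
rewrite (lower_rowE vx) (lower_rowE wy).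
rewrite (@lower_rowE _ (a *: v + w)); last first.
  by rewrite pivot_linear vx wy lower_row_linear.
by rewrite snd_half_linear // opprD -scalerN.
Qed.

(* The operator matrix with rows [0, I] and [- A, - D]; see [block_opE]. *)
Definition block_op : operator (hsum (Hhalf S) H) (hsum (Hhalf S) H) :=
  Operator block_dom0 block_dom_linear block_linear.

Lemma block_opE (z w : Hhalf S) (v : H) : posop_ext z + D w = pivot S v ->
  dom block_op (z, val w) /\ block_op (z, val w) = (w, - v).
Proof.
move=> Dv; have w2 : snd_half (z, val w) = w by rewrite /snd_half valKd.
have row : pivot S v = lower_row (z, val w) by rewrite /lower_row w2.
split; last by rewrite /= (lower_rowE row) w2.
by split; [exact: half_dom|exists v].
Qed.

(* [gamma] may be [+oo]; [delta] is finite when [D] is bounded, unless [H] is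
   the zero space. *)
Definition gamma : \bar R :=
  ereal_sup [set (complex.Re (D z z) / rnorm (val z) ^+ 2)%:E
            | z in [set z : Hhalf S | z != 0]].

Definition delta : \bar R :=
  ereal_inf [set (complex.Re (D z z) / rnorm z ^+ 2)%:E
            | z in [set z : Hhalf S | z != 0]].

End BlockOperator.

(* Main.v *)
Require Import Defs.
From HB Require Import structures.
From mathcomp Require Import all_boot all_order all_algebra.
From mathcomp Require Import sesquilinear.
From mathcomp Require Import all_classical all_reals all_analysis.
From mathcomp Require Import complex ring lra.

Set Implicit Arguments.
Unset Strict Implicit.
Unset Printing Implicit Defensive.

Import Order.TTheory GRing.Theory Num.Theory numFieldNormedType.Exports.
Local Open Scope classical_set_scope.
Local Open Scope ring_scope.
Local Open Scope complex_scope.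

(** The easy inclusion is a computation. On [(z, w)] the quadratic form of the
    block operator is [<w, z> - <z, w> - (D w) w], the first two brackets
    being inner products of [H_(1/2)]; see [block_op_inner]. The first two
    terms add up to a purely imaginary number of modulus at most [2 |w| |z|],
    so the real part is [- Re (D w) w], and sectoriality together with
    [delta |w|^2 <= Re (D w) w] bounds the imaginary part
    ([numerical_range_region]). The region is closed.

    For the spectrum, let [l] be at distance [d > 0] from the numerical range.
    Then [block_op - l] is bounded below by [d], and what has to be shown is
    that it is onto. In general a point outside the closed numerical range
    may belong to the spectrum; here it cannot, because the same quadratic form
    makes sense on the whole of [H_(1/2) x H_(1/2)], and the gap
    [d |x|^2 <= |<(block_op - l) x, x>|] extends to that space: for fixed [w],
    the [z] such that [(z, w)] is in the domain of the block operator are dense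
    in [H_(1/2)] ([block_dom_dense], [block_form_gap]).

    Solving [(block_op - l) (z, w) = (f, g)] forces [w = f + l z] and leaves
    one equation [schur l z = F] in [H_(-1/2)], where
    [schur l z = A z + l D z + l^2 z]. On the vectors [(z, l z)] the form of
    [block_op - l] equals [- conj l * (schur l z) z], so the gap becomes
    coercivity of [schur l] for the norm of [H_(1/2)] when [l != 0]
    ([schur_coercive]); for [l = 0] coercivity is trivial. The Lax-Milgram
    theorem ([lax_milgram]) then solves the equation.

    Lax-Milgram is reduced to its Hermitian case, which is proved by minimising
    the energy [(b x) x - 2 Re (f x)] in a complete space; the Riesz
    representation theorem is the instance where [b] is the inner product. *)

(** * Real and complex numbers *)

(** Used to pass to the limit in an inequality whose error terms are bounded
    for small [e] by a multiple of [e]. *)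
Lemma ler_add_epsM (R : realFieldType) (a b C : R) :
  (forall e, 0 < e <= 1 -> a <= b + e * C) -> a <= b.
Proof.
move=> h; rewrite leNgt; apply/negP => ba.
pose M := `|C| + (a - b) + 1.
have M0 : 0 < M by rewrite /M; have := normr_ge0 C; lra.
have /h : 0 < (a - b) / M <= 1.
  rewrite divr_gt0 ?subr_gt0 // ler_pdivrMr // mul1r /M.
  by have := normr_ge0 C; lra.
rewrite -lerBlDl mulrAC ler_pdivlMr // ler_pM2l ?subr_gt0 // /M.
by have := ler_norm C; lra.
Qed.

Lemma sqrtrD_le (R : rcfType) (a b : R) : 0 <= a -> 0 <= b ->
  Num.sqrt (a + b) <= Num.sqrt a + Num.sqrt b.
Proof.
move=> a0 b0; rewrite -(@ler_pXn2r _ 2) ?nnegrE ?addr_ge0 ?sqrtr_ge0 //.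
rewrite sqrrD !sqr_sqrtr ?addr_ge0 // addrAC lerDl.
by rewrite mulrn_wge0 ?mulr_ge0 ?sqrtr_ge0.
Qed.

Section Complex.
Variable R : realType.
Implicit Types x y z : R[i].
Local Notation Re := complex.Re.
Local Notation Im := complex.Im.

(** The modulus as an element of [R]; the norm of [R[i]] takes values in
    [R[i]]. *)
Definition cmod z : R := Re `|z|.

Lemma cmodE z : (cmod z)%:C = `|z|.
Proof. by rewrite RRe_real ?normr_real. Qed.

Lemma cmod_ge0 z : 0 <= cmod z.
Proof. by rewrite -ler0c cmodE. Qed.

Lemma cmodM x y : cmod (x * y) = cmod x * cmod y.
Proof. by apply: complexI; rewrite rmorphM /= !cmodE normrM. Qed.

Lemma cmodN z : cmod (- z) = cmod z.
Proof. by rewrite /cmod normrN. Qed.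

Lemma cmodD x y : cmod (x + y) <= cmod x + cmod y.
Proof. by rewrite -lecR rmorphD /= !cmodE ler_normD. Qed.

Lemma cmod_eq0 z : (cmod z == 0) = (z == 0).
Proof. by rewrite -(inj_eq (@complexI R)) cmodE normr_eq0. Qed.

Lemma cmod_real (a : R) : cmod a%:C = `|a|.
Proof. by rewrite /cmod normc_def /= expr0n addr0 sqrtr_sqr. Qed.

Lemma cReD x y : Re (x + y) = Re x + Re y.
Proof. by case: x y => [? ?] [? ?]. Qed.
Lemma cImD x y : Im (x + y) = Im x + Im y.
Proof. by case: x y => [? ?] [? ?]. Qed.
Lemma cReN x : Re (- x) = - Re x.
Proof. by case: x. Qed.
Lemma cImN x : Im (- x) = - Im x.
Proof. by case: x. Qed.
Lemma cReM x y : Re (x * y) = Re x * Re y - Im x * Im y.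
Proof. by case: x y => [? ?] [? ?]. Qed.
Lemma cImM x y : Im (x * y) = Re x * Im y + Im x * Re y.
Proof. by case: x y => [? ?] [? ?]. Qed.

Lemma conjCE z : Num.conj z = (z^*)%C.
Proof.
have [->|z0] := eqVneq z 0; first by rewrite conjC0 conjc0.
by apply: (mulfI z0); rewrite -normCK sqr_normc.
Qed.

Lemma cReJ z : Re (Num.conj z) = Re z.
Proof. by rewrite conjCE; case: z. Qed.
Lemma cImJ z : Im (Num.conj z) = - Im z.
Proof. by rewrite conjCE; case: z. Qed.

Lemma cmodJ z : cmod (Num.conj z) = cmod z.
Proof. by rewrite /cmod norm_conjC. Qed.

Lemma Re_le_cmod z : `|Re z| <= cmod z.
Proof. by rewrite -lecR cmodE normc_ge_Re. Qed.

Lemma Im_le_cmod z : `|Im z| <= cmod z.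
Proof.
rewrite -lecR cmodE normc_def lecR -[leLHS]ger0_norm // -sqrtr_sqr.
by rewrite ler_sqrt ?real_normK ?num_real ?lerDr ?addr_ge0 ?sqr_ge0.
Qed.

Lemma closure_ballP (E : set R[i]) l :
  closure (E : set R[i]^o) l <->
  forall e : R, 0 < e -> exists2 z, E z & cmod (l - z) < e.
Proof.
split=> [El e e0|El B].
  have [|z [Ez zl]] := El (ball (l : R[i]^o) e%:C).
    by apply: nbhsx_ballx; rewrite ltcR.
  by exists z => //; rewrite -ltcR cmodE; move: zl; rewrite -ball_normE.
move=> /nbhs_ballP[e /= e0 eB].
have eE : (complex.Re e)%:C = e by rewrite RRe_real // gtr0_real.
have [|z Ez zl] := El (complex.Re e); first by rewrite -ltcR eE.
exists z; split => //; apply: eB; rewrite -ball_normE /=.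
by rewrite -eE -cmodE ltcR.
Qed.

End Complex.

(** * Real-valued norms, inner products and antilinear functionals *)

Section RealNorm.
Variables (R : realType) (V : normedModType R[i]).
Implicit Types x y : V.

Lemma rnorm_ge0 x : 0 <= rnorm x.
Proof. by rewrite -ler0c rnormE. Qed.

Lemma rnormD x y : rnorm (x + y) <= rnorm x + rnorm y.
Proof. by rewrite -lecR rmorphD /= !rnormE ler_normD. Qed.

Lemma rnormN x : rnorm (- x) = rnorm x.
Proof. by rewrite /rnorm normrN. Qed.

Lemma rnormZ (a : R[i]) x : rnorm (a *: x) = cmod a * rnorm x.
Proof. by apply: complexI; rewrite rmorphM /= rnormE cmodE rnormE normrZ. Qed.

Lemma rnorm0_eq0 x : (rnorm x == 0) = (x == 0).
Proof. by rewrite -(inj_eq (@complexI R)) rnormE normr_eq0. Qed.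

Lemma ball_rnorm x y (e : R) : ball x e%:C y <-> rnorm (x - y) < e.
Proof. by rewrite -ball_normE /= -ltcR rnormE. Qed.

End RealNorm.

Section InnerReal.
Variables (R : realType) (V : preHilbertType R).
Implicit Types x y : V.

Lemma inner_self x : inner x x = (rnorm x ^+ 2)%:C.
Proof. by rewrite innerE rmorphXn /= rnormE. Qed.

Lemma cmod_inner x y : cmod (inner x y) <= rnorm x * rnorm y.
Proof. by rewrite -lecR rmorphM /= cmodE !rnormE inner_CauchySchwarz. Qed.

Lemma innerC x y : inner y x = Num.conj (inner x y).
Proof. by rewrite hermC expr0 mul1r. Qed.

Lemma innerZl a x y : inner (a *: x) y = a * inner x y.
Proof. exact: linearZl_LR. Qed.

Lemma innerZr a x y : inner x (a *: y) = Num.conj a * inner x y.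
Proof. exact: linearZr_LR. Qed.

Lemma innerDl x y z : inner (x + y) z = inner x z + inner y z.
Proof. exact: linearDl. Qed.

Lemma innerNl x y : inner (- x) y = - inner x y.
Proof. exact: linearNl. Qed.

Fact riesz_map_subproof x :
  (fun y : V => inner x y) \in @antidual_pred R V.
Proof.
apply/asboolP; split=> [a y z|]; first exact: linearPr.
by exists (rnorm x) => y; rewrite rnormE inner_CauchySchwarz.
Qed.

Definition riesz_map x : antidual V := Antidual (riesz_map_subproof x).

Lemma riesz_map_linear a x y :
  riesz_map (a *: x + y) = a *: riesz_map x + riesz_map y.
Proof. by apply: antidual_ext => z; exact: linearPl. Qed.

End InnerReal.

Section Antidual.
Variables (R : realType) (V : normedModType R[i]).
Implicit Types f g : antidual V.

Lemma antidual_cmod f x : cmod (f x) <= rnorm f * rnorm x.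
Proof.
rewrite -lecR rmorphM /= cmodE (rnormE f) rnormE.
exact: (@antidual_norm_bound _ _ f x).
Qed.

Lemma antidual_rnorm_le f (M : R) : 0 <= M ->
  (forall x, cmod (f x) <= M * rnorm x) -> rnorm f <= M.
Proof.
move=> M0 hM; rewrite -lecR rnormE lecR.
apply: antidual_norm_le => x x1; rewrite -cmodE lecR (le_trans (hM x)) //.
by rewrite ler_piMr // -lecR rnormE.
Qed.

Lemma antidual_addE f g x : (f + g) x = f x + g x.
Proof. by []. Qed.

Lemma antidual_oppE f x : (- f) x = - f x.
Proof. by []. Qed.

Lemma antidual_scaleE (a : R[i]) f x : (a *: f) x = a * f x.
Proof. by []. Qed.

Lemma antidual0 f : f 0 = 0.
Proof. by rewrite -{1}[0](scale0r 0) antidualZ conjC0 mul0r. Qed.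

End Antidual.

(** * The Lax-Milgram theorem *)

Section LaxMilgram.
Variables (R : realType) (V : hilbertType R).
Local Notation Re := complex.Re.
Local Notation Im := complex.Im.

(** An antilinear functional is determined by its real part, through
    [Re (f ('i y)) = Im (f y)]. *)
Lemma antidual_ReP (f g : antidual V) :
  (forall y, Re (f y) = Re (g y)) -> f = g.
Proof.
move=> fg; apply: antidual_ext => y; apply/eqP; rewrite eq_complex fg eqxx /=.
have := fg ('i *: y); rewrite !antidualZ !cReM cReJ cImJ /=.
by rewrite !mul0r !sub0r !mulN1r !opprK => ->.
Qed.

Section Hermitian.
Variables (b : V -> antidual V) (c : R) (f : antidual V).
Hypothesis bL : forall a x y, b (a *: x + y) = a *: b x + b y.
Hypothesis b_herm : forall x y, b y x = Num.conj (b x y).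
Hypothesis c_gt0 : 0 < c.
Hypothesis b_coercive : forall x, c * rnorm x ^+ 2 <= Re (b x x).

(* The energy; its minimisers solve [b x = f]. *)
Let J x := Re (b x x) - 2 * Re (f x).

Let JE x y (t : R) :
  J (x + t%:C *: y) = J x + 2 * t * Re (b x y - f y) + t ^+ 2 * Re (b y y).
Proof.
rewrite /J [x + _]addrC bL antidual_addE antidual_scaleE !antidual_linear.
rewrite (b_herm x y) !(cReD, cReM, cImD, cImM, cReN, cReJ, cImJ) /=.
by ring.
Qed.

Let J_bounded : has_lbound [set J x | x in setT].
Proof.
exists (- (rnorm f ^+ 2 / c)) => _ [x _ <-].
have fx : Re (f x) <= rnorm f * rnorm x.
  by rewrite (le_trans (ler_norm _)) // (le_trans (Re_le_cmod _)) ?antidual_cmod.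
have bx := b_coercive x.
have sq : 0 <= c * (rnorm x - rnorm f / c) ^+ 2.
  by rewrite mulr_ge0 ?sqr_ge0 // ltW.
have e : c * (rnorm x - rnorm f / c) ^+ 2 =
  c * rnorm x ^+ 2 - 2 * (rnorm f * rnorm x) + rnorm f ^+ 2 / c.
  by field; rewrite gt_eqF.
rewrite e in sq; rewrite /J; lra.
Qed.

Let m := inf [set J x | x in setT].

Let m_le x : m <= J x.
Proof. by apply: ge_inf => //; exists x. Qed.

Let near_min e : 0 < e -> exists x, J x < m + e.
Proof.
move=> e0; have [|_ [x _ <-] Jx] := @inf_adherent _ [set J x | x in setT] e e0.
  by split=> //; exists (J 0), 0.
by exists x.
Qed.

(* The filter generated by the sets of almost minimisers. *)
Let minF : set_system V := filter_from [set e : R | 0 < e]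
  (fun e => [set x | J x < m + e]).

Let minF_filter : Filter minF.
Proof.
apply: filter_from_filter; first by exists 1 => /=.
move=> d e d0 e0; exists (Num.min d e) => /=; first by rewrite lt_min d0.
move=> x /= Jx; split=> /=; apply: (lt_le_trans Jx);
  by rewrite lerD2l ge_min lexx ?orbT.
Qed.

Let minF_proper : ProperFilter minF.
Proof. by apply: filter_from_proper => // e /near_min[x]; exists x. Qed.

Let minF_cvg : exists x : V, minF --> x.
Proof.
apply/cvg_ex; apply: (@cauchy_cvg _ minF minF_proper).
apply: (@cauchy_exP _ _ minF minF_filter) => e e0.
have [r rE] : exists r : R, r%:C = e.
  by exists (Re e); rewrite RRe_real // gtr0_real.
have r0 : 0 < r by rewrite -ltcR rE.
have d0 : 0 < c * r ^+ 2 / 4 by rewrite divr_gt0 // mulr_gt0 // exprn_gt0.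
have [x Jx] := near_min d0; exists x, (c * r ^+ 2 / 4) => // y /= Jy.
rewrite -rE; apply/ball_rnorm.
(* The midpoint of [x] and [y] has energy
   [(J x + J y) / 2 - (b (y - x)) (y - x) / 4], which is at least [m]. *)
have := m_le (x + (2^-1 : R)%:C *: (y - x)).
have := JE x (y - x) 1; rewrite scale1r subrKC !JE.
have := b_coercive (y - x); rewrite -rnormN opprB => h1 h2 h3.
rewrite -(@ltr_pXn2r _ 2) ?nnegrE ?rnorm_ge0 ?(ltW r0) // -(ltr_pM2l c_gt0).
lra.
Qed.

(** Almost minimisers of the energy form a Cauchy filter because [b] is
    coercive. At the limit the derivative of the energy in each direction
    vanishes: for fixed [y], the map [x |-> (b x) y] is continuous, being the
    conjugate of the bounded functional [b y]. *)
Lemma hermitian_coercive_surj : exists x, b x = f.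
Proof.
have [x Fx] := minF_cvg; exists x; apply: antidual_ReP => y.
have Q0 : 0 <= Re (b y y).
  by rewrite (le_trans _ (b_coercive y)) // mulr_ge0 ?sqr_ge0 ?ltW.
set Q := Re (b y y) in Q0.
suff h e : 0 < e -> `|Re (b x y - f y)| <= e * (1 + rnorm (b y) + Q).
  have K0 : 0 < 1 + rnorm (b y) + Q by have := rnorm_ge0 (b y); lra.
  apply/eqP; rewrite -subr_eq0 -cReN -cReD -normr_le0 leNgt; apply/negP => n0.
  have := h (`|Re (b x y - f y)| / (1 + rnorm (b y) + Q) / 2).
  rewrite !divr_gt0 // => /(_ isT); rewrite mulrAC divfK ?gt_eqF //; lra.
move=> e0.
have [z [/= Jz xz]] : [set z | J z < m + e ^+ 2] `&` ball x e%:C !=set0.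
  apply: (@filter_ex _ minF minF_proper); apply: (@filterI _ minF minF_filter).
    by exists (e ^+ 2) => //=; rewrite exprn_gt0.
  by apply: Fx; apply: nbhsx_ballx; rewrite ltcR.
have {}xz : rnorm (x - z) < e by apply/ball_rnorm.
have zx : `|Re (b (x - z) y)| <= e * rnorm (b y).
  rewrite b_herm cReJ (le_trans (Re_le_cmod _)) //.
  rewrite (le_trans (antidual_cmod _ _)) //.
  by rewrite mulrC ler_wpM2r ?rnorm_ge0 // ltW.
(* As [J z < m + e^2], moving by [e] in the directions [y] and [- y] controls
   the derivative of [J] at [z]. *)
have zy : `|Re (b z y - f y)| <= e * (1 + Q).
  have h1 := m_le (z + e%:C *: y).
  have h2 := m_le (z + (- e)%:C *: y).
  rewrite !JE -/Q in h1 h2.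
  by rewrite ler_norml -(ler_pM2l e0) -[X in _ && X](ler_pM2l e0); lra.
have -> : Re (b x y - f y) = Re (b (x - z) y) + Re (b z y - f y).
  have -> : b x = b (x - z) + b z.
    by rewrite -[b (x - z)]scale1r -bL scale1r subrK.
  by rewrite antidual_addE !cReD; lra.
rewrite (le_trans (ler_normD _ _)) // (le_trans (lerD zx zy)) //; lra.
Qed.

End Hermitian.

(** The Riesz representation theorem. *)
Lemma riesz_map_surj (f : antidual V) : exists x, riesz_map x = f.
Proof.
apply: (@hermitian_coercive_surj _ 1) => //; first exact: riesz_map_linear.
  by move=> x y; exact: innerC.
by move=> x; rewrite mul1r [riesz_map x x]inner_self.
Qed.

Lemma inner_ext (x y : V) : (forall z, inner z x = inner z y) -> x = y.
Proof.
move=> xy; apply/eqP; rewrite -subr_eq0 -(dnorm_eq0 (@inner R V)).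
by rewrite linearBr /= xy subrr.
Qed.

(** Coercivity is in modulus, so the energy method does not apply to [T]
    itself. Let [B] be the operator with [(T x) y = <x, B y>]. Then [T \o B] is
    Hermitian, since [(T (B x)) y = <B x, B y>], and it is coercive because [B]
    is bounded below; it is therefore onto, and so is [T]. *)
Lemma lax_milgram (T : V -> antidual V) (c M : R) :
  (forall a x y, T (a *: x + y) = a *: T x + T y) ->
  (forall x, rnorm (T x) <= M * rnorm x) ->
  0 < c -> (forall x, c * rnorm x ^+ 2 <= cmod (T x x)) ->
  forall f, exists x, T x = f.
Proof.
move=> TL TM c0 Tc f.
have conjT y : (fun x => Num.conj (T x y)) \in @antidual_pred R V.
  apply/asboolP; split=> [a u v|].
    by rewrite TL antidual_addE antidual_scaleE rmorphD rmorphM.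
  exists (M * rnorm y) => x; rewrite -cmodE -rnormE -rmorphM lecR cmodJ.
  rewrite (le_trans (antidual_cmod _ _)) // mulrAC.
  by rewrite ler_wpM2r ?rnorm_ge0.
have /boolp.choice[B BE] y : exists z, forall x, T x y = inner x z.
  have [z zE] := riesz_map_surj (Antidual (conjT y)); exists z => x.
  by rewrite innerC -[inner z x]/(riesz_map z x) zE /= conjCK.
have BL a x y : B (a *: x + y) = a *: B x + B y.
  by apply: inner_ext => z; rewrite -BE antidual_linear !BE [RHS]linearPr.
have [|x y|||x <-] := @hermitian_coercive_surj (T \o B) (c ^+ 2) f;
  last by exists (B x).
- by move=> a x y; rewrite /= BL TL.
- by rewrite /= !BE innerC.
- by rewrite exprn_gt0.
move=> x; rewrite /= BE inner_self /= -exprMn.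
rewrite ler_pXn2r ?nnegrE ?mulr_ge0 ?rnorm_ge0 ?(ltW c0) //.
have [->|x0] := eqVneq (rnorm x) 0; first by rewrite mulr0 rnorm_ge0.
have xp : 0 < rnorm x by rewrite lt_def x0 rnorm_ge0.
rewrite -(ler_pM2l xp) mulrCA -expr2 (le_trans (Tc x)) // BE.
exact: cmod_inner.
Qed.

End LaxMilgram.

(** * Completeness of the form domain *)

Section FormSpace.
Variables (R : realType) (H : hilbertType R) (A : posop H) (S : sqrtop A).

Lemma sqrt_distE (x y : Hhalf S) : `|S (val x) - S (val y)| = `|x - y|.
Proof.
rewrite half_norm; congr `|_|.
have -> : val (x - y) = (-1) *: val y + val x by rewrite scaleN1r addrC.
by rewrite op_linear ?scaleN1r 1?addrC //; exact: half_dom.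
Qed.

(** [S] is an isometry from [Hhalf S] onto [H], so completeness carries over
    from [H]. *)
Fact half_complete (F : set_system (Hhalf S)) :
  ProperFilter F -> cauchy F -> cvg F.
Proof.
move=> FF /(@cauchyP _ _ F) cF; pose G := (fun z : Hhalf S => S (val z)) @ F.
have cG : cvg G.
  apply: cauchy_cvg; apply: cauchy_exP => e /cF[x Fx]; exists (S (val x)).
  rewrite /G /=; apply: (@filterS _ F _ _ _ _ Fx) => y.
  rewrite -!ball_normE => xy.
  by rewrite /= sqrt_distE.
have [u [_ Su uE]] := sqrt_surj S (lim G).
apply/cvg_ex; exists (Half (introT (asboolP _) Su)).
apply/cvgrPdist_lt => e e0.
have /cvgrPdist_lt/(_ e e0) : G --> lim G by exact: cG.
by apply: filterS => z; rewrite -uE => uz; rewrite -sqrt_distE.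
Qed.

HB.instance Definition _ := Uniform_isComplete.Build (Hhalf S) half_complete.

End FormSpace.

(** * Points outside the closed numerical range *)

Section NumericalRange.
Variables (R : realType) (V : preHilbertType R) (T : operator V V).

Lemma operator0 : T 0 = 0.
Proof.
have := @op_linear _ _ _ T 1 0 0 (dom0 T) (dom0 T).
by rewrite scaler0 addr0 scale1r -{1}[T 0]addr0 => /addrI.
Qed.

Lemma domZ (a : R[i]) x : dom T x -> dom T (a *: x).
Proof.
by move=> Tx; rewrite -[a *: x]addr0; apply: dom_linear => //; exact: dom0.
Qed.

Lemma operatorZ (a : R[i]) x : dom T x -> T (a *: x) = a *: T x.
Proof.
move=> Tx; rewrite -{1}[a *: x]addr0 op_linear ?operator0 ?addr0 //.
exact: dom0.
Qed.

(** The distance from [l] to the numerical range gives [d] on unit vectors; the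
    rest is homogeneity. *)
Lemma numerical_range_gap (l : R[i]) :
  ~ closure (numerical_range T : set R[i]^o) l ->
  exists2 d : R, 0 < d &
    forall x, dom T x -> d * rnorm x ^+ 2 <= cmod (inner (T x - l *: x) x).
Proof.
move=> Wl.
have [d d0 hd] : exists2 d : R, 0 < d &
    forall z, numerical_range T z -> d <= cmod (l - z).
  apply: contrapT => h; apply: Wl; apply/closure_ballP => e e0.
  apply: contrapT => he; apply: h; exists e => // z Wz.
  by rewrite leNgt; apply/negP => ze; apply: he; exists z.
exists d => // x Tx.
have [->|x0] := eqVneq x 0.
  by rewrite /rnorm normr0 /= expr0n mulr0 cmod_ge0.
have n0 : rnorm x != 0 by rewrite rnorm0_eq0.
pose u := ((rnorm x)^-1)%:C *: x.
have xu : x = (rnorm x)%:C *: u.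
  by rewrite /u scalerA -rmorphM mulfV //= scale1r.
have u1 : `|u| = 1.
  rewrite -rnormE rnormZ cmod_real ger0_norm ?invr_ge0 ?rnorm_ge0 //.
  by rewrite mulVf.
have Tu : dom T u by exact: domZ.
have uE (r : R) : inner (T (r%:C *: u) - l *: (r%:C *: u)) (r%:C *: u) =
    (r ^+ 2)%:C * (inner (T u) u - l).
  rewrite operatorZ // scalerA [l * _]mulrC -scalerA -scalerBr.
  rewrite linearZl_LR linearZr_LR /= linearBl linearZl_LR /=.
  rewrite [inner u u]innerE u1 expr1n mulr1 mulrA; congr (_ * _).
  by rewrite conjCE conjc_real -rmorphM -expr2.
have := uE (rnorm x); rewrite -xu => ->.
rewrite cmodM cmod_real ger0_norm ?sqr_ge0 // mulrC ler_wpM2l ?sqr_ge0 //.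
by rewrite -cmodN opprB hd //; exists u.
Qed.

Lemma bounded_below_gap (l : R[i]) (d : R) :
  (forall x, dom T x -> d * rnorm x ^+ 2 <= cmod (inner (T x - l *: x) x)) ->
  forall x, dom T x -> d * rnorm x <= rnorm (T x - l *: x).
Proof.
move=> hd x Tx; have [->|x0] := eqVneq (rnorm x) 0.
  by rewrite mulr0 rnorm_ge0.
have xp : 0 < rnorm x by rewrite lt_def x0 rnorm_ge0.
rewrite -(ler_pM2r xp) -mulrA -expr2 (le_trans (hd x Tx)) //.
exact: cmod_inner.
Qed.

Lemma resolvent_of_gap (l : R[i]) (d : R) : 0 < d ->
  (forall x, dom T x -> d * rnorm x <= rnorm (T x - l *: x)) ->
  (forall y, exists2 x, dom T x & T x - l *: x = y) ->
  resolvent_set T l.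
Proof.
move=> d0 hd surj; split; last first.
  by exists d^-1 => x Tx; rewrite ler_pdivlMl // hd.
split=> // [x y /set_mem Tx /set_mem Ty /= xy|y _]; last first.
  by have [x Tx xy] := surj y; exists x.
apply/eqP; rewrite -subr_eq0 -rnorm0_eq0.
have E : x - y = (-1) *: y + x by rewrite scaleN1r addrC.
have Txy : dom T (x - y) by rewrite E; exact: dom_linear.
have := hd _ Txy; rewrite {2}E op_linear // scaleN1r scalerBr.
have -> : - T y + T x - (l *: x - l *: y) =
   (T x - l *: x) - (T y - l *: y).
  rewrite !opprB [- T y + _]addrC [l *: y - l *: x]addrC addrACA.
  by rewrite [- T y + _]addrC.
rewrite xy subrr {2}/rnorm normr0 /= => h.
have := rnorm_ge0 (x - y); rewrite le_eqVlt => /orP[/eqP<- //|n0].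
by have := mulr_gt0 d0 n0; rewrite ltNge h.
Qed.

End NumericalRange.

(** * The quadratic form of the block operator *)

Section BlockForm.
Variables (R : realType) (H : hilbertType R) (A : posop H) (S : sqrtop A).
Variable D : {linear Hhalf S -> Hmhalf S}.
Implicit Types z w : Hhalf S.

(** The quadratic form of [block_op D] at [(z, w)]. It is defined for all [z]
    and [w] in [Hhalf S], whether or not [(z, w)] is in the domain of the
    operator. *)
Definition block_form z w : R[i] := inner w z - inner z w - D w w.

Lemma block_dom_inv x : dom (block_op D) x ->
  exists z w v, x = (z, val w) /\ posop_ext z + D w = pivot S v.
Proof.
case: x => z y [/= Sy [v _ vE]]; exists z, (insubd 0 y), v.
by split=> //; congr (_, _); rewrite insubdK //; exact/asboolP.
Qed.

Lemma block_op_inner z w v : posop_ext z + D w = pivot S v ->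
  inner (block_op D (z, val w)) (z, val w) = block_form z w.
Proof.
move=> zwv; rewrite (block_opE zwv).2 /= [LHS]/(inner w z + inner (- v) (val w)).
rewrite linearNl -[LHS]/(inner w z - pivot S v w).
by rewrite -zwv antidual_addE /block_form opprD addrA.
Qed.

Lemma hsum_rnorm z w :
  rnorm ((z, val w) : hsum (Hhalf S) H) ^+ 2 = rnorm z ^+ 2 + rnorm (val w) ^+ 2.
Proof.
by apply: complexI; rewrite -inner_self rmorphD /= -!inner_self.
Qed.

Lemma block_op_sub_inner (l : R[i]) z w v : posop_ext z + D w = pivot S v ->
  let x : hsum (Hhalf S) H := (z, val w) in
  inner (block_op D x - l *: x) x =
  block_form z w - l * (rnorm z ^+ 2 + rnorm (val w) ^+ 2)%:C.
Proof.
move=> zwv x; rewrite linearBl linearZl_LR -hsum_rnorm -inner_self.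
by congr (_ - _); exact: (block_op_inner zwv).
Qed.

(** Since [S] maps [Hhalf S] isometrically onto [H], and [dom A] onto [dom S],
    this is the density of [dom S] in [H]. *)
Lemma dom_posop_dense z (e : R) : 0 < e ->
  exists2 u, dom A (val u) & rnorm (z - u) < e.
Proof.
move=> e0.
have [|y [yB Sy]] := (sqrt_sa S).1 (ball (S (val z)) e%:C) _ (ball_open _ _).
  by exists (S (val z)); apply: ballxx; rewrite ltcR.
have [u [_ Su uy]] := sqrt_surj S y.
exists (Half (introT (asboolP _) Su)).
  suff : [set x | dom S x /\ dom S (S x)] (S u) by rewrite sqrt_dom.
  by split => //; rewrite uy.
by rewrite -ltcR rnormE -sqrt_distE /= uy; move: yB; rewrite -ball_normE.
Qed.

(** With [p] the Riesz representative of [D w], the condition that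
    [posop_ext z' + D w] is in [H] becomes [z' + p \in dom A], and [dom A] is
    dense. *)
Lemma block_dom_dense z w (e : R) : 0 < e ->
  exists z' v, rnorm (z - z') < e /\ posop_ext z' + D w = pivot S v.
Proof.
move=> e0; have [p pE] := riesz_map_surj (D w).
have [u Au ue] := dom_posop_dense (z + p) e0.
exists (u - p), (A (val u)); split.
  by rewrite opprB addrCA addrA [p + z]addrC.
rewrite -posop_extE // -pE; apply: antidual_ext => x.
by rewrite -{2}[u](subrK p) [RHS]linearDl.
Qed.

(** Both sides are continuous in [z] for the norm of [Hhalf S], so the gap
    passes from the domain of the operator to all pairs by
    [block_dom_dense]. *)
Lemma block_form_gap (l : R[i]) (d : R) : 0 < d ->
  (forall x, dom (block_op D) x ->
    d * rnorm x ^+ 2 <= cmod (inner (block_op D x - l *: x) x)) ->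
  forall z w, d * (rnorm z ^+ 2 + rnorm (val w) ^+ 2) <=
    cmod (block_form z w - l * (rnorm z ^+ 2 + rnorm (val w) ^+ 2)%:C).
Proof.
move=> d0 hd z w.
set n := rnorm z ^+ 2 + _.
apply: (@ler_add_epsM _ _ _
  (2 * rnorm w + (cmod l + d) * (2 * rnorm z + 1))) => e.
move=> /andP[e0 e1]; have [z' [v [zz' zE]]] := block_dom_dense z w e0.
pose u := z - z'.
have : d * (rnorm z' ^+ 2 + rnorm (val w) ^+ 2) <=
    cmod (block_form z' w - l * (rnorm z' ^+ 2 + rnorm (val w) ^+ 2)%:C).
  by rewrite -(block_op_sub_inner l zE) -hsum_rnorm; exact: hd (block_opE zE).1.
set n' := rnorm z' ^+ 2 + _ => hn'.
have nn' : `|n' - n| <= e * (2 * rnorm z + 1).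
  have h1 : rnorm z <= rnorm z' + e.
    by rewrite -[z in leLHS](subrKC z') (le_trans (rnormD _ _)) // lerD2l ltW.
  have h2 : rnorm z' <= rnorm z + e.
    rewrite -[z' in leLHS](subrKC z) (le_trans (rnormD _ _)) // lerD2l.
    by rewrite -rnormN opprB ltW.
  have := rnorm_ge0 z; have := rnorm_ge0 z'.
  by rewrite ler_norml /n /n'; nra.
have BE : block_form z' w - l * n'%:C = (block_form z w - l * n%:C) +
    (- (inner w u - inner u w) - l * (n' - n)%:C).
  rewrite /u /block_form linearBl linearBr /= rmorphB /=; ring.
have iu : cmod (- (inner w u - inner u w)) <= 2 * e * rnorm w.
  rewrite cmodN (le_trans (cmodD _ _)) // cmodN.
  have := cmod_inner w u; have := cmod_inner u w.
  by have := rnorm_ge0 w; rewrite -/u in zz'; nra.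
have lu : cmod (- (l * (n' - n)%:C)) <= cmod l * (e * (2 * rnorm z + 1)).
  by rewrite cmodN cmodM cmod_real ler_wpM2l ?cmod_ge0.
have dn : d * n <= d * n' + d * (e * (2 * rnorm z + 1)).
  by rewrite -mulrDr ler_pM2l //; move: nn'; rewrite ler_norml; lra.
rewrite BE in hn'; have := cmodD (block_form z w - l * n%:C)
  (- (inner w u - inner u w) - l * (n' - n)%:C).
have := cmodD (- (inner w u - inner u w)) (- (l * (n' - n)%:C)).
lra.
Qed.

End BlockForm.

(** * The spectrum *)

Section Spectrum.
Variables (R : realType) (H : hilbertType R) (A : posop H) (S : sqrtop A).
Variable D : {linear Hhalf S -> Hmhalf S}.
Implicit Types z w : Hhalf S.

Lemma pivot_val_bounded : exists2 M : R, 0 <= M &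
  forall z, rnorm (pivot S (val z)) <= M * rnorm z.
Proof.
have [M0 hM0] := sqrt_bounded_below S; exists (`|M0| ^+ 2).
  by rewrite exprn_ge0.
have hM z : rnorm (val z) <= `|M0| * rnorm z.
  rewrite (le_trans (hM0 _ (half_dom z))) // {2}/rnorm half_norm.
  by rewrite ler_wpM2r ?rnorm_ge0 // ler_norm.
move=> z; apply: antidual_rnorm_le => [|x].
  by rewrite mulr_ge0 ?exprn_ge0 ?rnorm_ge0.
rewrite pivotE (le_trans (cmod_inner _ _)) //.
rewrite (le_trans (ler_pM _ _ (hM z) (hM x))) ?rnorm_ge0 //.
by rewrite expr2 mulrACA mulrA.
Qed.

(** Up to sign, what is left of [block_op D - l] after elimination of the
    second component through [w = f + l z]. *)
Definition schur (l : R[i]) z : Hmhalf S :=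
  posop_ext z + (l *: D z + l ^+ 2 *: pivot S (val z)).

Lemma schur_linear l a z w : schur l (a *: z + w) = a *: schur l z + schur l w.
Proof.
have valL : val (a *: z + w) = a *: val z + val w by rewrite linearP.
rewrite /schur posop_ext_linear linearP valL pivot_linear.
apply: antidual_ext => x; rewrite !(antidual_addE, antidual_scaleE); ring.
Qed.

Lemma schur_bounded l : bounded_op D -> bounded_op (schur l).
Proof.
move=> [M hM]; have [N N0 hN] := pivot_val_bounded.
exists (1 + (cmod l * M + cmod (l ^+ 2) * N)) => z.
rewrite (le_trans (rnormD _ _)) // mulrDl lerD //.
  by rewrite mul1r -lecR !rnormE posop_ext_norm.
rewrite (le_trans (rnormD _ _)) // mulrDl !rnormZ -!mulrA.
by rewrite lerD // ler_wpM2l ?cmod_ge0.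
Qed.

Lemma schurE l z x :
  schur l z x = inner z x + (l * D z x + l ^+ 2 * inner (val z) (val x)).
Proof. by []. Qed.

(** Restricted to the vectors [(z, l z)], on which the first row of
    [block_op D - l] vanishes, the form of [block_op D - l] is that of
    [schur l] up to a factor. *)
Lemma block_form_schur l z :
  block_form D z (l *: z) - l * (rnorm z ^+ 2 + rnorm (val (l *: z)) ^+ 2)%:C =
  - (Num.conj l * schur l z z).
Proof.
have valZ : val (l *: z) = l *: val z by rewrite linearZ.
have -> (a b : R) : (a + b)%:C = a%:C + b%:C by rewrite rmorphD.
rewrite valZ -!inner_self schurE /block_form (linearZZ D).
rewrite antidual_scaleE antidualZ.
rewrite !innerZl !innerZr; ring.
Qed.

(** For [l != 0] the constant is [d / |l|], by [block_form_schur] and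
    [block_form_gap]. At [l = 0] the operator is [posop_ext], whose form is the
    square of the norm of [Hhalf S]. *)
Lemma schur_coercive l (d : R) : 0 < d ->
  (forall x, dom (block_op D) x ->
    d * rnorm x ^+ 2 <= cmod (inner (block_op D x - l *: x) x)) ->
  exists2 c : R, 0 < c & forall z, c * rnorm z ^+ 2 <= cmod (schur l z z).
Proof.
move=> d0 hd; have [->|l0] := eqVneq l 0.
  exists 1 => // z; rewrite schurE expr0n !mul0r !addr0 mul1r.
  by rewrite inner_self cmod_real ler_norm.
have lp : 0 < cmod l by rewrite lt_def cmod_eq0 l0 cmod_ge0.
exists (d / cmod l); first by rewrite divr_gt0.
move=> z; rewrite mulrAC ler_pdivrMr //.
have := block_form_gap d0 hd z (l *: z).
rewrite block_form_schur cmodN cmodM cmodJ [leRHS]mulrC; apply: le_trans.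
by rewrite ler_pM2l // lerDl sqr_ge0.
Qed.

Lemma block_op_surj l (d : R) : bounded_op D -> 0 < d ->
  (forall x, dom (block_op D) x ->
    d * rnorm x ^+ 2 <= cmod (inner (block_op D x - l *: x) x)) ->
  forall y, exists2 x, dom (block_op D) x & block_op D x - l *: x = y.
Proof.
move=> DB d0 hd [f g].
have [c c0 hc] := schur_coercive d0 hd; have [M hM] := schur_bounded l DB.
(* The right-hand side is what remains of the second row after the
   substitution [w = f + l z]. *)
have [z zE] := lax_milgram (schur_linear l) hM c0 hc
  (- (pivot S g + (D f + l *: pivot S (val f)))).
pose w := f + l *: z; pose v := - (g + l *: val w).
have zwv : posop_ext z + D w = pivot S v.
  have wE : val w = val f + l *: val z by rewrite linearD linearZ.
  apply: antidual_ext => x; have := congr1 (fun h : Hmhalf S => h x) zE.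
  rewrite schurE /v wE /w (linearD D) (linearZZ D).
  rewrite !(antidual_addE, antidual_scaleE, antidual_oppE) !pivotE.
  rewrite innerNl !innerDl innerZl innerDl innerZl => E.
  apply/eqP; rewrite -subr_eq0; move/eqP: E; rewrite -subr_eq0 => /eqP <-.
  by apply/eqP; ring.
exists ((z, val w) : hsum (Hhalf S) H); first exact: (block_opE zwv).1.
rewrite (block_opE zwv).2.
have -> : (w, - v) - l *: ((z, val w) : hsum (Hhalf S) H) =
  (w - l *: z, - v - l *: val w) by [].
by rewrite /w addrK /v opprK addrK.
Qed.

Lemma spectrum_sub_closure : bounded_op D ->
  spectrum (block_op D) `<=`
    closure (numerical_range (block_op D) : set R[i]^o).
Proof.
move=> DB l; apply: contra_notP => /numerical_range_gap[d d0 hd].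
apply: (resolvent_of_gap d0); first exact: bounded_below_gap.
exact: block_op_surj DB d0 hd.
Qed.

End Spectrum.

(** * The region containing the numerical range *)

Section Region.
Variables (R : realType) (H : hilbertType R) (A : posop H) (S : sqrtop A).
Variable D : {linear Hhalf S -> Hmhalf S}.
Local Notation Re := complex.Re.
Local Notation Im := complex.Im.
Implicit Types z w : Hhalf S.

Lemma Re_block_form z w : Re (block_form D z w) = - Re (D w w).
Proof.
by rewrite /block_form (innerC w z) !(cReD, cReN) cReJ subrr add0r.
Qed.

Lemma Im_block_form z w :
  Im (block_form D z w) = 2 * Im (inner w z) - Im (D w w).
Proof.
by rewrite /block_form (innerC w z) !(cImD, cImN) cImJ; ring.
Qed.

Hypothesis D_accretive : forall z, 0 <= Re (D z z).

(** If [w = 0] then [z != 0], and [gamma D] is at least the nonnegative quotient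
    at [z]. Otherwise it is at least the quotient at [w], whose denominator is
    at most 1. *)
Lemma Re_le_gamma z w : (z, w) != 0 -> rnorm (val w) <= 1 ->
  ((Re (D w w))%:E <= gamma D)%E.
Proof.
have sup z' : z' != 0 -> ((Re (D z' z') / rnorm (val z') ^+ 2)%:E <= gamma D)%E.
  by move=> z0; apply: ereal_sup_ubound; exists z'.
have [-> z0 _|w0 _ w1] := eqVneq w 0.
  have {}z0 : z != 0 by apply: contraNneq z0 => ->.
  apply: le_trans (sup z z0); rewrite antidual0 lee_fin.
  by rewrite divr_ge0 ?sqr_ge0.
apply: le_trans (sup w w0); rewrite lee_fin ler_pdivlMr.
  by rewrite ler_piMr // exprn_ile1 ?rnorm_ge0.
rewrite exprn_gt0 // lt_def rnorm_ge0 andbT rnorm0_eq0.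
by apply: contra_neq w0 => w0; apply: val_inj.
Qed.

Hypothesis delta_gt0 : (0 < delta D)%E.

(** A nonzero [w] bounds [delta D] from above, so that [delta D] is finite and
    [fine] keeps its value; for [w = 0] the left-hand side is zero. *)
Lemma rnorm_le_delta w :
  rnorm w <= Num.sqrt ((fine (delta D))^-1 * Re (D w w)).
Proof.
have [->|w0] := eqVneq w 0; first by rewrite /rnorm normr0 /= sqrtr_ge0.
have wp : 0 < rnorm w by rewrite lt_def rnorm_ge0 rnorm0_eq0 w0.
have : (delta D <= (Re (D w w) / rnorm w ^+ 2)%:E)%E.
  by apply: ereal_inf_lbound; exists w.
move: delta_gt0; case: (delta D) => // d; rewrite lte_fin lee_fin => d0 dw /=.
rewrite -[leLHS]ger0_norm ?rnorm_ge0 // -sqrtr_sqr ler_sqrt.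
  by rewrite ler_pdivlMl // -ler_pdivlMr ?exprn_gt0.
by rewrite mulr_ge0 ?invr_ge0 ?(ltW d0).
Qed.

Variable k : R.
Hypothesis k_ge0 : 0 <= k.
Hypothesis D_sectorial : forall z, `|Im (D z z)| <= k * Re (D z z).

Lemma numerical_range_region (l : R[i]) : numerical_range (block_op D) l ->
  [/\ (- gamma D <= (Re l)%:E)%E, Re l <= 0 &
    `|Im l| <= k * `|Re l| + 2 * Num.sqrt ((fine (delta D))^-1 * `|Re l|)].
Proof.
move=> [x [/block_dom_inv[z [w [v [-> zwv]]]] /= x1]].
have -> : inner (block_op D (z, val w)) (z, val w) = block_form D z w.
  exact: (block_op_inner zwv).
move=> <-; rewrite Re_block_form Im_block_form normrN (ger0_norm (D_accretive w)).
have n1 : rnorm z ^+ 2 + rnorm (val w) ^+ 2 = 1.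
  by rewrite -hsum_rnorm /rnorm x1 /= expr1n.
have zwn0 : (z, w) != 0.
  apply/eqP => -[z0 w0]; move/eqP: n1; rewrite z0 w0 /rnorm.
  by rewrite linear0 !normr0 /= expr0n addr0 eq_sym oner_eq0.
have z1 : rnorm z <= 1.
  by rewrite -(@ler_pXn2r _ 2) ?nnegrE ?rnorm_ge0 // expr1n -n1 lerDl sqr_ge0.
have w1 : rnorm (val w) <= 1.
  by rewrite -(@ler_pXn2r _ 2) ?nnegrE ?rnorm_ge0 // expr1n -n1 lerDr sqr_ge0.
split; first by rewrite EFinN leeN2 (Re_le_gamma zwn0).
  by rewrite oppr_le0.
rewrite (le_trans (ler_normB _ _)) // addrC lerD //.
rewrite normrM ger0_norm // ler_pM2l // (le_trans (Im_le_cmod _)) //.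
rewrite (le_trans (cmod_inner _ _)) // (le_trans _ (rnorm_le_delta w)) //.
by rewrite ler_piMr ?rnorm_ge0.
Qed.

(** The region is closed. In the last inequality, an approximation within
    [t^2] costs at most a multiple of [t], because of the square root. *)
Lemma closure_numerical_range_region (l : R[i]) :
  closure (numerical_range (block_op D) : set R[i]^o) l ->
  [/\ (- gamma D <= (Re l)%:E)%E, Re l <= 0 &
    `|Im l| <= k * `|Re l| + 2 * Num.sqrt ((fine (delta D))^-1 * `|Re l|)].
Proof.
move=> /closure_ballP Wl; have approx (e : R) : 0 < e -> exists q,
    [/\ (- gamma D <= (Re q)%:E)%E, Re q <= 0,
    `|Im q| <= k * `|Re q| + 2 * Num.sqrt ((fine (delta D))^-1 * `|Re q|),
    `|Re l - Re q| < e & `|Im l - Im q| < e].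
  move=> /Wl[q /numerical_range_region[q1 q2 q3] lq]; exists q; split=> //.
    by rewrite -cReN -cReD (le_lt_trans (Re_le_cmod _)).
  by rewrite -cImN -cImD (le_lt_trans (Im_le_cmod _)).
split.
- have : forall e : R, 0 < e -> (- gamma D <= (Re l + e)%:E)%E.
    move=> e /approx[q [q1 _ _ + _]]; rewrite ltr_norml => /andP[lq _].
    by apply: (le_trans q1); rewrite lee_fin; lra.
  case: (gamma D) => [g| |] h; last 2 first.
  + by rewrite leNye.
  + by have := h 1 ltr01; rewrite leNgt ltry.
  by rewrite -EFinN lee_fin; apply/ler_addgt0Pr => e /h; rewrite -EFinN lee_fin.
- apply: (@ler_add_epsM _ _ _ 1) => e /andP[/approx[q [_ q2 _ + _]] _].
  by rewrite ltr_norml; lra.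
set c := (fine (delta D))^-1.
have c0 : 0 <= c by rewrite invr_ge0 fine_ge0 // ltW.
apply: (@ler_add_epsM _ _ _ (k + 1 + 2 * Num.sqrt c)) => t /andP[t0 t1].
have [|q [_ _]] := approx (t ^+ 2); first by rewrite exprn_gt0.
rewrite -/c => q3 lq iq.
have tt : t ^+ 2 <= t by rewrite expr2 ler_piMr // ltW.
have Rq : `|Re q| <= `|Re l| + t ^+ 2.
  rewrite -[Re q](subrKC (Re l)) (le_trans (ler_normD _ _)) // lerD2l.
  by rewrite distrC ltW.
have Il : `|Im l| <= `|Im q| + t ^+ 2.
  by rewrite -[Im l](subrKC (Im q)) (le_trans (ler_normD _ _)) // lerD2l ltW.
have sq : Num.sqrt (c * `|Re q|) <= Num.sqrt (c * `|Re l|) + Num.sqrt c * t.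
  have -> : Num.sqrt c * t = Num.sqrt (c * t ^+ 2).
    by rewrite sqrtrM // sqrtr_sqr ger0_norm // ltW.
  have cl0 : 0 <= c * `|Re l| by rewrite mulr_ge0.
  have ct0 : 0 <= c * t ^+ 2 by rewrite mulr_ge0 ?exprn_ge0 // ltW.
  rewrite (le_trans _ (sqrtrD_le cl0 ct0)) // ler_sqrt ?addr_ge0 //.
  by rewrite -mulrDr ler_wpM2l.
have kq : k * `|Re q| <= k * `|Re l| + k * t.
  by rewrite -mulrDr ler_wpM2l // (le_trans Rq) // lerD2l.
lra.
Qed.

End Region.

(** * The spectral inclusion *)

Theorem proposition3p8 (R : realType) (H : hilbertType R) (A0 : posop H)
    (S : sqrtop A0) (D : {linear Hhalf S -> Hmhalf S}) (k : R)
    (D_bounded : bounded_op D)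
    (D_accretive : forall z : Hhalf S, 0 <= complex.Re (D z z))
    (D_H1 : forall z : Hhalf S, dom A0 (val z) -> exists v : H, D z = pivot S v)
    (k_ge0 : 0 <= k)
    (D_sectorial : forall z : Hhalf S,
      `|complex.Im (D z z)| <= k * complex.Re (D z z))
    (delta_gt0 : (0 < delta D)%E) :
  spectrum (block_op D) `<=`
    closure (numerical_range (block_op D) : set R[i]^o) /\
  closure (numerical_range (block_op D) : set R[i]^o) `<=`
    [set l : R[i] | [/\ (- gamma D <= (complex.Re l)%:E)%E,
      complex.Re l <= 0 &
      `|complex.Im l| <= k * `|complex.Re l| +
        2 * Num.sqrt ((fine (delta D))^-1 * `|complex.Re l|)]].
Proof.
split; first exact: spectrum_sub_closure.
move=> l; exact: closure_numerical_range_region.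
Qed.
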